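(* Let $k$ be a positive integer. There exist nonnegative integers $c_{j,q}$ ($0\le q\le k-1$, $0\le j\le k$) and $d_{j,q}$ ($0\le q\le k-1$, $0\le j\le k$) such that for all $n\ge k$ $$A_{\ell_1,n}(2k)=\binom{n-k}{k}+\sum_{q=0}^{k-1}\sum_{j=0}^{k}c_{j,q}\binom{n-j}{q},\qquad V_{\ell_1,n}(2k)=\binom{n-k}{k}+\sum_{q=0}^{k-1}\sum_{j=0}^{k}d_{j,q}\binom{n-j}{q}.$$ In particular, for $n\ge k$ both $A_{\ell_1,n}(2k)$ and $V_{\ell_1,n}(2k)$ equal $\binom{n-k}{k}$ plus positive terms that are polynomials in $n$ of degree at most $k-1$.
   Context: $S_n$ is the group of permutations of $\{1,\dots,n\}$. For $u\in S_n$, $\ell_1(u)=\sum_{i=1}^n|u(i)-i|$ (the $\ell_1$ distance from the identity). $A_{\ell_1,n}(R)=\#\{u\in S_n:\ell_1(u)=R\}$ and $V_{\ell_1,n}(R)=\#\{u\in S_n:\ell_1(u)\le R\}$. *)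

(* Defs.v *)
From mathcomp Require Import all_boot all_order all_algebra all_fingroup.

Set Implicit Arguments.
Unset Strict Implicit.
Unset Printing Implicit Defensive.

(* {1,...,n} is modelled by 'I_n = {0,...,n-1}; the shift leaves every
   difference u(i) - i unchanged.  The subtraction inside `| _ |%N is the one
   of int, so it is not truncated. *)
Definition ell1 (n : nat) (u : 'S_n) : nat := \sum_(i < n) `|u i - i|%N.

Definition A_ell1 (n R : nat) : nat := #|[set u : 'S_n | ell1 u == R]|.

Definition V_ell1 (n R : nat) : nat := #|[set u : 'S_n | ell1 u <= R]|.

(* Main.v *)
Require Import Defs.
From mathcomp Require Import all_boot all_order all_algebra all_fingroup.
From mathcomp Require Import zify.

(** Since [u] is a bijection, its l1 distance to the identity is twice its excess
    [\sum_i max (u i - i, 0)].  The excess adds up over the decomposition of [u]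
    into indecomposable blocks, and such a block of size [m + 1] has excess at least
    [m].  Splitting off the first block, the number [a n k] of permutations of
    excess [k] satisfies
    [a (n+1) k - a n k = \sum_(1 <= m <= s <= k) i m s * a (n-m) (k-s)],
    where [i m s] counts the indecomposable permutations of size [m + 1] and
    excess [s].  Summing over [n] turns ['C(n - j, q)] into ['C(n - j, q + 1)], so
    by induction on [k] only the transpositions ([m = s = 1]) contribute to
    the top binomial ['C(n - k, k)]. *)

(** * Excess and indecomposable permutations *)

Definition excess {n} (u : 'S_n) : nat := \sum_(i < n) (u i - i).

Lemma ell1_excess n (u : 'S_n) : ell1 u = 2 * excess u.
Proof.
have deficit : \sum_(i < n) (i - u i) = excess u.
  (* Pointwise, [u i + (i - u i)] and [i + (u i - i)] are both the maximum of [i] and [u i]; and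
     [u i] and [i] have equal sums. *)
  apply: (@addnI (\sum_(i < n) (u i : nat))).
  transitivity (\sum_(i < n) (i : nat) + excess u).
    by rewrite -!big_split; apply: eq_bigr => i _ /=; lia.
  by rewrite [in LHS](reindex_inj (@perm_inj _ u)).
rewrite mulSn mul1n -[X in _ = X + _]deficit -big_split.
by apply: eq_bigr => i _ /=; lia.
Qed.

(** Mapping the first [t] points into themselves suffices, as injectivity makes it onto. In [indec]
    below only the proper cuts [1, ..., m] are tested. *)
Definition stabilizes {n} (u : 'S_n) t := [forall i : 'I_n, (i < t) ==> (u i < t)].

Definition indec {m} (u : 'S_m.+1) := [forall t : 'I_m, ~~ stabilizes u t.+1].

(** With [a = i] and [b = u i], this turns [u i - i] into the number of cuts crossed between [i] and
    [u i]. *)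
Lemma sum_interval a b m : \sum_(t < m) (a <= t < b) = minn m b - a.
Proof.
elim: m => [|m IHm]; first by rewrite big_ord0 min0n.
by rewrite big_ord_recr /= IHm; case: (leqP a m); case: (ltnP m b) => /=; lia.
Qed.

(* Every cut t | t+1 is crossed from left to right at least once. *)
Lemma indec_excess m (u : 'S_m.+1) : indec u -> m <= excess u.
Proof.
move/forallP=> iu.
have -> : excess u = \sum_(i < m.+1) \sum_(t < m) (i <= t < u i).
  apply: eq_bigr => i _.
  by rewrite sum_interval (minn_idPr _) // -ltnS ltn_ord.
rewrite exchange_big -[leqLHS]card_ord -sum1_card leq_sum // => t _.
have := iu t; rewrite negb_forall => /existsP[i]; rewrite negb_imply => /andP[it ut].
by rewrite (bigD1 i) //= (_ : i <= t < u i) // -ltnS it /=; move: ut; rewrite -leqNgt.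
Qed.

(** * Direct sums of permutations *)

Section DirectSum.
Context {a b : nat}.

Definition dsum_fun (u : 'S_a) (v : 'S_b) (i : 'I_(a + b)) : 'I_(a + b) :=
  match split i with inl x => lshift b (u x) | inr y => rshift a (v y) end.

Lemma dsum_inj u v : injective (dsum_fun u v).
Proof.
move=> i j; rewrite /dsum_fun.
case: (split_ordP i) => x ->; case: (split_ordP j) => y -> /eqP;
  rewrite ?eq_shift // => /eqP/perm_inj -> //.
Qed.

Definition dsum u v : 'S_(a + b) := perm (dsum_inj u v).

Lemma dsuml u v x : dsum u v (lshift b x) = lshift b (u x).
Proof. by rewrite permE /dsum_fun (unsplitK (inl x)). Qed.

Lemma dsumr u v y : dsum u v (rshift a y) = rshift a (v y).
Proof. by rewrite permE /dsum_fun (unsplitK (inr y)). Qed.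

Lemma excess_dsum u v : excess (dsum u v) = excess u + excess v.
Proof.
rewrite /excess big_split_ord; congr (_ + _); apply: eq_bigr => i _.
  by rewrite dsuml.
by rewrite dsumr /= subnDl.
Qed.

Lemma stabilizes_dsum u v t :
  t <= a -> stabilizes (dsum u v) t = stabilizes u t.
Proof.
move=> ta; apply/forallP/forallP => H i; apply/implyP => it.
  by have /implyP := H (lshift b i); rewrite dsuml; apply.
case: (split_ordP i) it => x -> /= it; last by lia.
by rewrite dsuml; have /implyP := H x; apply.
Qed.

Lemma dsum_injective : injective (fun p : 'S_a * 'S_b => dsum p.1 p.2).
Proof.
move=> [u v] [u' v'] /= /permP e; congr (_, _); apply/permP => x.
  by have := e (lshift b x); rewrite !dsuml => /lshift_inj.
by have := e (rshift a x); rewrite !dsumr => /rshift_inj.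
Qed.

Lemma dsum_surj (w : 'S_(a + b)) :
  stabilizes w a -> exists p : 'S_a * 'S_b, w = dsum p.1 p.2.
Proof.
move=> /forallP sw.
(* The default [x] is never reached, since [w] keeps the left part; likewise for [y] in [g]. *)
pose f x := if split (w (lshift b x)) is inl y then y else x.
have fE x : w (lshift b x) = lshift b (f x).
  rewrite /f; case: (split_ordP (w (lshift b x))) => // y e.
  by have := sw (lshift b x); rewrite e /= ltn_ord /=; lia.
have fI : injective f.
  by move=> x y e; apply: (@lshift_inj a b); apply: (@perm_inj _ w); rewrite !fE e.
pose g y := if split (w (rshift a y)) is inr z then z else y.
have gE y : w (rshift a y) = rshift a (g y).
  rewrite /g; case: (split_ordP (w (rshift a y))) => // z e.
  (* Being injective on a finite set, [f] is onto, so [lshift b z] is already the image of a left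
     point. *)
  have := fE (invF fI z); rewrite f_invF -e => /perm_inj/eqP.
  by rewrite eq_shift.
have gI : injective g.
  by move=> x y e; apply: (@rshift_inj a b); apply: (@perm_inj _ w); rewrite !gE e.
exists (perm fI, perm gI); apply/permP => i /=.
by case: (split_ordP i) => x ->; rewrite ?dsuml ?dsumr permE.
Qed.

End DirectSum.

(** * Recursion on the first indecomposable block *)

Definition count_excess n k := #|[set u : 'S_n | excess u == k]|.
Definition count_indec m s := #|[set u : 'S_m.+1 | indec u & excess u == s]|.

(** Such [w] correspond to pairs of an indecomposable block and an arbitrary rest. The size is a
    variable [n] with an equation, to avoid casts between permutation types. *)
Lemma first_block_card m b n k : n = m.+1 + b ->
  #|[set w : 'S_n | [&& stabilizes w m.+1,
       [forall t : 'I_m, ~~ stabilizes w t.+1] & excess w == k]]| =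
  \sum_(s < k.+1) count_indec m s * count_excess b (k - s).
Proof.
move=> ->.
pose D := [set p : 'S_m.+1 * 'S_b | indec p.1 & excess p.1 + excess p.2 == k].
have -> : [set w : 'S_(m.+1 + b) | [&& stabilizes w m.+1,
       [forall t : 'I_m, ~~ stabilizes w t.+1] & excess w == k]]
   = [set dsum p.1 p.2 | p in D].
  apply/setP => w; rewrite inE; apply/and3P/imsetP => [[sw iw ew]|[[u v]]].
    have [[u v] /= wE] := dsum_surj w sw; exists (u, v) => //.
    rewrite inE /= -excess_dsum -wE ew andbT.
    apply/forallP => t; have /forallP/(_ t) := iw.
    by rewrite wE stabilizes_dsum // ltnS ltnW.
  rewrite inE /= => /andP[/forallP iu euv] ->; split.
  - rewrite stabilizes_dsum //; apply/forallP => i; apply/implyP => _; exact: ltn_ord.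
  - by apply/forallP => t; rewrite stabilizes_dsum // ltnS ltnW.
  - by rewrite excess_dsum.
rewrite card_imset; last exact: dsum_injective.
(* Sort by the excess of the first block; it is at most [k], so [inord] does not alter it. *)
rewrite -sum1_card (partition_big (fun p => inord (excess p.1) : 'I_k.+1) xpredT) //=.
apply: eq_bigr => s _; rewrite -cardsX -sum1_card; apply: eq_bigl => -[u v].
rewrite !inE /= -andbA; case: (indec u) => //=.
rewrite -val_eqE /=; apply/andP/andP => [[/eqP e]|[/eqP e1 /eqP e2]].
  rewrite inordK; last by lia.
  by move=> /eqP <-; split => //; apply/eqP; lia.
by rewrite inordK ?e1 ?e2 ?ltn_ord // subnKC // -ltnS.
Qed.

Lemma count_excessS n k :
  count_excess n.+1 k =
  \sum_(m < n.+1) \sum_(s < k.+1) count_indec m s * count_excess (n - m) (k - s).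
Proof.
(* The first block ends at the least stabilized cut; [ord_max] is a valid candidate because the cut
   after it is always stabilized. *)
pose fb (w : 'S_n.+1) := [arg min_(i < (ord_max : 'I_n.+1) | stabilizes w i.+1) i].
rewrite /count_excess -sum1_card (partition_big fb xpredT) //=.
apply: eq_bigr => m _; rewrite -(first_block_card m _ n.+1) -?sum1_card; last first.
  by rewrite addSn subnKC // -ltnS.
apply: eq_bigl => w; rewrite !inE andbC andbA; congr (_ && _).
rewrite /fb; case: arg_minnP => [|i si mini].
  by apply/forallP => i; apply/implyP => _; exact: ltn_ord.
apply/eqP/andP => [<-|[sm /forallP im]].
  split=> //; apply/forallP => t; apply/negP => st.
  have tn : t < n.+1 by apply: (ltn_trans (ltn_ord t)).
  by have /= := mini (Ordinal tn) st; rewrite leqNgt ltn_ord.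
have := mini m sm; rewrite leq_eqVlt => /orP[/eqP/val_inj // | lim].
by have := im (Ordinal lim); rewrite /= si.
Qed.

Lemma count_excess0 k : count_excess 0 k = (k == 0).
Proof.
rewrite /count_excess (_ : [set _ | _] = if k == 0 then setT else set0).
  by case: ifP; rewrite ?cards0 // cardsT card_Sn.
by apply/setP=> u; rewrite inE /excess big_ord0 eq_sym; case: ifP; rewrite inE.
Qed.

Lemma count_indec_small m s : s < m -> count_indec m s = 0.
Proof.
move=> sm; apply/eqP; rewrite cards_eq0; apply/eqP/setP => u; rewrite !inE.
by apply/negbTE/negP => /andP[/indec_excess + /eqP e]; rewrite e leqNgt sm.
Qed.

Lemma count_indec0 s : count_indec 0 s = (s == 0).
Proof.
rewrite /count_indec (_ : [set _ | _ & _] = if s == 0 then setT else set0).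
  by case: ifP; rewrite ?cards0 // cardsT card_Sn.
apply/setP=> u; rewrite inE /excess big_ord1 !ord1 subnn eq_sym.
by rewrite (_ : indec u) ?[if _ then _ else _]fun_if;
  [case: ifP; rewrite inE | apply/forallP=> -[]].
Qed.

(** The transposition is the only indecomposable permutation of two points; this gives the top
    binomial its coefficient 1. *)
Lemma count_indec1 : count_indec 1 1 = 1.
Proof.
rewrite /count_indec; apply/eqP/cards1P; exists (tperm ord0 ord_max).
apply/setP => u; rewrite !inE /excess big_ord_recl big_ord1 /= subn0.
apply/andP/eqP => [[_ /eqP e]|->].
  have I2 (x : 'I_2) : x = if x == 0 :> nat then ord0 else ord_max.
    by apply/val_inj; case: x => -[|[]].
  have u0 : u ord0 = ord_max.
    rewrite [LHS]I2; case: eqP => // u0; rewrite u0 add0n in e.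
    by have := ltn_ord (u (lift ord0 ord0)); rewrite -subn_gt0 -[bump 0 0]/1 in e *; lia.
  apply/permP => x; rewrite [x]I2; case: ifP => _; rewrite ?tpermL ?tpermR //.
  rewrite [LHS]I2; case: eqP => // /eqP ne.
  have : u ord_max = u ord0 by rewrite u0 [LHS]I2 (negPf ne).
  by move/perm_inj.
rewrite tpermL (_ : lift ord0 ord0 = ord_max); last exact: val_inj.
rewrite tpermR; split=> //; apply/forallP => t; rewrite ord1 /=.
by rewrite negb_forall; apply/existsP; exists ord0; rewrite tpermL.
Qed.

(* Vanishes for [n < m], where truncated subtraction would give [f 0]. *)
Definition shift m (f : nat -> nat) n := (m <= n) * f (n - m).

Lemma count_excessS_shift n k :
  count_excess n.+1 k = count_excess n k +
    \sum_(s < k) \sum_(m < k)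
      count_indec m.+1 s.+1 * shift m.+1 (count_excess ^~ (k - s.+1)) n.
Proof.
rewrite count_excessS big_ord_recl; congr (_ + _).
  rewrite big_ord_recl big1 => [|s _]; last by rewrite count_indec0.
  by rewrite count_indec0 mul1n addn0 !subn0.
rewrite (eq_bigr (fun m : 'I_n => \sum_(s < k)
    count_indec m.+1 s.+1 * count_excess (n - m.+1) (k - s.+1))) => [|m _].
  rewrite exchange_big; apply: eq_bigr => s _.
  (* Both ranges of [m] are widened to [n + k]: terms with [m >= n] are killed by [shift], those
     with [m >= k] by [count_indec_small]. *)
  rewrite (big_ord_widen _ (fun m => count_indec m.+1 s.+1 *
    count_excess (n - m.+1) (k - s.+1)) (leq_addr k n)).
  rewrite (big_ord_widen _ (fun m => count_indec m.+1 s.+1 *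
    shift m.+1 (count_excess^~ (k - s.+1)) n) (leq_addl n k)).
  rewrite big_mkcond [RHS]big_mkcond; apply: eq_bigr => m _ /=; rewrite /shift.
  have [km|_] := leqP k m; last by case: ifP; rewrite ?mul0n ?muln0 ?mul1n.
  rewrite count_indec_small ?if_same //.
  by rewrite ltnS (leq_trans (ltn_ord s)).
by rewrite big_ord_recl count_indec_small.
Qed.

(** * Nonnegative combinations of shifted binomials *)

Definition sbin j q := shift j (binomial^~ q).

Lemma shift_shift m j f n : shift m (shift j f) n = shift (m + j) f n.
Proof.
rewrite /shift mulnA mulnb subnDA; congr (_ * _); congr (nat_of_bool _); lia.
Qed.

(** Hockey-stick identity. The cutoff in [sbin] is essential at [q = 0], where truncated subtraction
    would add a 1 for each [i < j]. *)
Lemma sum_sbin j q n : \sum_(i < n) sbin j q i = sbin j q.+1 n.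
Proof.
elim: n => [|n IHn]; first by rewrite big_ord0 /sbin /shift sub0n bin0n muln0.
rewrite big_ord_recr /= {}IHn /sbin /shift; case: (ltngtP j n.+1) => [jn|jn|->].
- by rewrite -ltnS jn subSn // binS !mul1n.
- by rewrite leqNgt (ltn_trans _ jn).
- by rewrite ltnn subnn bin0n.
Qed.

(** Repetitions in the list encode nonnegative integer coefficients, so no coefficient arithmetic is
    needed. *)
Definition sbin_span K Q (f : nat -> nat) :=
  exists2 l : seq (nat * nat), all (fun x => (x.1 <= K) && (x.2 < Q)) l
  & forall n, f n = \sum_(x <- l) sbin x.1 x.2 n.

Lemma sbin_span_ext {K Q f g} : sbin_span K Q f -> f =1 g -> sbin_span K Q g.
Proof. by move=> [l lP fE] e; exists l => // n; rewrite -e. Qed.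

Lemma sbin_span0 K Q : sbin_span K Q (fun=> 0).
Proof. by exists [::] => // n; rewrite big_nil. Qed.

Lemma sbin_spanD {K Q f g} :
  sbin_span K Q f -> sbin_span K Q g -> sbin_span K Q (fun n => f n + g n).
Proof.
move=> [l lP fE] [l' lP' gE]; exists (l ++ l'); first by rewrite all_cat lP.
by move=> n; rewrite big_cat fE gE.
Qed.

Lemma sbin_span_sum {K Q} {I : Type} (r : seq I) {f : I -> nat -> nat} :
  (forall i, sbin_span K Q (f i)) -> sbin_span K Q (fun n => \sum_(i <- r) f i n).
Proof.
move=> fP; elim: r => [|i r IHr].
  by apply: sbin_span_ext (sbin_span0 K Q) _ => n; rewrite big_nil.
by apply: sbin_span_ext (sbin_spanD (fP i) IHr) _ => n; rewrite big_cons.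
Qed.

Lemma sbin_spanZ {K Q c f} : sbin_span K Q f -> sbin_span K Q (fun n => c * f n).
Proof.
move=> fP; apply: sbin_span_ext (sbin_span_sum (nseq c tt) (fun=> fP)) _ => n.
by rewrite big_nseq iter_addn_0 mulnC.
Qed.

Lemma sbin_spanW {K Q K' Q' f} :
  K <= K' -> Q <= Q' -> sbin_span K Q f -> sbin_span K' Q' f.
Proof.
move=> le_K le_Q [l lP fE]; exists l => //; apply: sub_all lP => x /andP[xK xQ].
by rewrite (leq_trans xK) ?(leq_trans xQ).
Qed.

Lemma sbin_span_sbin {K Q j q} : j <= K -> q < Q -> sbin_span K Q (sbin j q).
Proof. by exists [:: (j, q)] => [|n]; rewrite ?big_seq1 //= andbT; apply/andP. Qed.

Lemma sbin_span_shift {K Q m f} :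
  sbin_span K Q f -> sbin_span (m + K) Q (shift m f).
Proof.
move=> [l lP fE]; exists [seq (m + x.1, x.2) | x <- l].
  by rewrite all_map; apply: sub_all lP => x /=; rewrite leq_add2l.
move=> n; rewrite big_map /shift fE big_distrr /=; apply: eq_bigr => x _.
exact: shift_shift.
Qed.

Lemma sbin_span_partial_sum {K Q f} :
  sbin_span K Q f -> sbin_span K Q.+1 (fun n => \sum_(i < n) f i).
Proof.
move=> [l lP fE]; exists [seq (x.1, x.2.+1) | x <- l].
  by rewrite all_map; apply: sub_all lP => x.
move=> n; rewrite big_map; under [LHS]eq_bigr do rewrite fE; rewrite exchange_big.
by apply: eq_bigr => x _; rewrite sum_sbin.
Qed.

(** * The leading binomial, by induction on the excess *)

Lemma count_excess_sbin k :
  exists2 f, sbin_span k k f & forall n, count_excess n k = sbin k k n + f n.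
Proof.
elim/ltn_ind: k => -[|k] IHk.
  exists (fun=> 0) => [|n]; first exact: sbin_span0.
  elim: n => [|n IHn]; first by rewrite count_excess0.
  by rewrite count_excessS_shift IHn big_ord0 addn0 /sbin /shift !bin0.
pose D n := \sum_(s < k.+1) \sum_(m < k.+1)
  count_indec m.+1 s.+1 * shift m.+1 (count_excess ^~ (k.+1 - s.+1)) n.
have aE n : count_excess n k.+1 = \sum_(i < n) D i.
  elim: n => [|n IHn]; first by rewrite count_excess0 big_ord0.
  by rewrite count_excessS_shift IHn [RHS]big_ord_recr.
(* Summing the increments [D] raises each lower index by one and keeps the shifts. *)
suff [g gP DE]: exists2 g, sbin_span k.+1 k g & forall n, D n = sbin k.+1 k n + g n.
  exists (fun n => \sum_(i < n) g i); first exact: sbin_span_partial_sum.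
  move=> n; rewrite aE; under [LHS]eq_bigr do rewrite DE.
  by rewrite big_split /= sum_sbin.
have [f fP fE] := IHk k (ltnSn k).
have restP (s : 'I_k) : sbin_span k.+1 k (fun n => \sum_(m < k.+1)
    count_indec m.+1 s.+2 * shift m.+1 (count_excess ^~ (k.+1 - s.+2)) n).
  apply: sbin_span_sum => m.
  have [sm|ms] := ltnP s.+1 m.
    apply: sbin_span_ext (sbin_span0 _ _) _ => n.
    by rewrite count_indec_small.
  have [h hP hE] := IHk (k.+1 - s.+2) ltac:(lia).
  (* The rest has excess [k - s.+1], which bounds its lower indices and shifts; as [m <= s.+1], the
     total shift is at most [k.+1]. *)
  apply/sbin_spanZ/(sbin_spanW (K := m.+1 + (k - s.+1)) (Q := (k - s.+1).+1)).
  - have := ltn_ord s; lia.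
  - have := ltn_ord s; lia.
  apply: sbin_span_shift.
  apply: sbin_span_ext (sbin_spanD (sbin_span_sbin (leqnn _) (ltnSn _))
                                   (sbin_spanW (leqnn _) (leqnSn _) hP)) _ => n.
  by rewrite -hE.
exists (fun n => shift 1 f n + \sum_(s < k) \sum_(m < k.+1)
    count_indec m.+1 s.+2 * shift m.+1 (count_excess ^~ (k.+1 - s.+2)) n).
  by apply: sbin_spanD; [apply: (sbin_span_shift (m := 1))|apply: sbin_span_sum].
move=> n; rewrite /D big_ord_recl addnA; congr (_ + _).
(* A first block of excess 1 has at most two points, so only the transposition remains. *)
rewrite big_ord_recl big1 => [|m _]; last by rewrite count_indec_small.
rewrite count_indec1 mul1n addn0 subSS subn0.
by rewrite /sbin -(shift_shift 1 k) -mulnDr /shift fE.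
Qed.

(** * Back to spheres and balls *)

Lemma A_ell1_count n k : A_ell1 n (2 * k) = count_excess n k.
Proof.
by apply: eq_card => u; rewrite !inE ell1_excess eqn_pmul2l.
Qed.

Lemma V_ell1_count n k : V_ell1 n (2 * k) = \sum_(i < k.+1) count_excess n i.
Proof.
rewrite /V_ell1 -sum1_card.
rewrite (partition_big (fun u => inord (excess u) : 'I_k.+1) xpredT) //=.
apply: eq_bigr => i _; rewrite /count_excess -sum1_card; apply: eq_bigl => u.
rewrite !inE ell1_excess leq_pmul2l // -val_eqE /=.
have [uk|uk] := leqP (excess u) k; first by rewrite inordK.
by apply/esym/eqP => e; move: (ltn_ord i); rewrite -e ltnS leqNgt uk.
Qed.

(** Only excess exactly [k] reaches the lower index [k]; for [i < k] even the leading [sbin i i]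
    goes into the remainder. *)
Lemma V_ell1_sbin k :
  exists2 f, sbin_span k k f & forall n, V_ell1 n (2 * k) = sbin k k n + f n.
Proof.
have [f fP fE] := count_excess_sbin k.
exists (fun n => \sum_(i < k) count_excess n i + f n).
  apply: sbin_spanD fP; apply: sbin_span_sum => i.
  have [g gP gE] := count_excess_sbin i.
  apply: sbin_span_ext (sbin_spanD
    (sbin_span_sbin (ltnW (ltn_ord i)) (ltn_ord i))
    (sbin_spanW (ltnW (ltn_ord i)) (ltnW (ltn_ord i)) gP)) _ => n.
  by rewrite gE.
by move=> n; rewrite V_ell1_count big_ord_recr /= fE addnCA.
Qed.

(** The coefficients are the multiplicities in the list, and [j <= k <= n] makes every cutoff equal
    to 1. *)
Lemma sbin_span_bin {k f} : sbin_span k k f ->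
  exists c : 'I_k.+1 -> 'I_k -> nat, forall n, k <= n ->
    f n = \sum_(q < k) \sum_(j < k.+1) c j q * 'C(n - j, q).
Proof.
move=> [l lP fE]; exists (fun j q => count_mem (j : nat, q : nat) l) => n kn.
rewrite fE {fE}; elim: l lP => [_|[j q] l IHl /= /andP[/andP[/= jk qk] /IHl lE]].
  by rewrite big_nil big1 // => q _; rewrite big1.
rewrite big_cons {}lE.
under [RHS]eq_bigr do (under eq_bigr do rewrite mulnDl; rewrite big_split).
rewrite big_split; congr (_ + _).
rewrite (bigD1 (Ordinal qk)) //= (bigD1 (Ordinal (jk : j < k.+1))) //= eqxx mul1n.
rewrite !big1 ?addn0; first by rewrite /sbin /shift (leq_trans jk) // mul1n.
- move=> i /eqP ne; rewrite big1 // => i' _; case: eqP => // -[_ e].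
  by case: ne; apply: val_inj.
- by move=> i /eqP ne; case: eqP => // -[e]; case: ne; apply: val_inj.
Qed.

(** * The remainders as sums of polynomials *)

Import GRing.Theory Num.Theory.
Local Open Scope ring_scope.

Lemma prod_sub_ffact (R : comNzRingType) N q :
  \prod_(i < q) (N%:R - i%:R) = (N ^_ q)%:R :> R.
Proof.
elim: q => [|q IHq]; first by rewrite big_ord0.
rewrite big_ord_recr /= IHq ffactnSr natrM.
(* For [N < q] the truncated [N - q] differs from the ring difference, but the falling factorial is
   already 0. *)
have [qN|Nq] := leqP q N; first by rewrite natrB.
by rewrite ffact_small // !mul0r.
Qed.

(** The binomial coefficient of [X - j] over [q], with roots [j, ..., j + q - 1]. *)
Definition bin_poly j q : {poly rat} :=
  (q`!%:R)^-1 *: \prod_(i < q) ('X - (j + i)%:R%:P).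

Lemma size_bin_poly j q : size (bin_poly j q) = q.+1.
Proof.
rewrite size_scale ?invr_eq0 ?pnatr_eq0 -?lt0n ?fact_gt0 //.
by rewrite size_prod_XsubC /index_enum -enumT size_enum_ord.
Qed.

Lemma bin_polyE j q n : (j <= n)%N -> (bin_poly j q).[n%:R] = 'C(n - j, q)%:R.
Proof.
move=> jn; rewrite hornerZ horner_prod.
under eq_bigr do rewrite hornerXsubC natrD opprD addrA -natrB //.
rewrite prod_sub_ffact -bin_ffact natrM mulrC mulfK //.
by rewrite pnatr_eq0 -lt0n fact_gt0.
Qed.

(** Each list entry yields its own polynomial, of degree below [k], whose values at [n >= k] are
    binomial coefficients. *)
Lemma sbin_span_poly {k f} : sbin_span k k f ->
  exists2 s : seq {poly rat},
    forall p, p \in s -> (size p <= k)%N /\ forall n, (k <= n)%N -> 0 <= p.[n%:R]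
  & forall n, (k <= n)%N -> (f n)%:R = \sum_(p <- s) p.[n%:R].
Proof.
move=> [l /allP lP fE]; exists [seq bin_poly x.1 x.2 | x <- l].
  move=> _ /mapP[x /lP/andP[xk xq] ->]; rewrite size_bin_poly; split=> // n kn.
  by rewrite bin_polyE ?ler0n // (leq_trans xk).
move=> n kn; rewrite fE big_map natr_sum; apply: eq_big_seq => x /lP/andP[xk _].
by rewrite bin_polyE /sbin /shift (leq_trans xk) // mul1n.
Qed.
Local Close Scope ring_scope.

Theorem theorem4p2 (k : nat) (hk : 0 < k) :
  (exists c d : 'I_k.+1 -> 'I_k -> nat,
     forall n : nat, k <= n ->
       A_ell1 n (2 * k) =
         'C(n - k, k) + \sum_(q < k) \sum_(j < k.+1) c j q * 'C(n - j, q)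
       /\
       V_ell1 n (2 * k) =
         'C(n - k, k) + \sum_(q < k) \sum_(j < k.+1) d j q * 'C(n - j, q))
  /\
  (exists s t : seq {poly rat},
     (forall p : {poly rat}, p \in s ++ t ->
        size p <= k /\ forall n : nat, k <= n -> (0 <= p.[n%:R])%R) /\
     forall n : nat, k <= n ->
       ((A_ell1 n (2 * k))%:R =
          'C(n - k, k)%:R + \sum_(p <- s) p.[n%:R])%R
       /\
       ((V_ell1 n (2 * k))%:R =
          'C(n - k, k)%:R + \sum_(p <- t) p.[n%:R])%R).
Proof.
have [f fP AE] := count_excess_sbin k.
have [g gP VE] := V_ell1_sbin k.
have sbinE n : k <= n -> sbin k k n = 'C(n - k, k).
  by rewrite /sbin /shift => ->; rewrite mul1n.
split.
  have [c cE] := sbin_span_bin fP; have [d dE] := sbin_span_bin gP.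
  exists c, d => n kn.
  by rewrite A_ell1_count AE VE sbinE // cE ?dE.
have [s sP sE] := sbin_span_poly fP; have [t tP tE] := sbin_span_poly gP.
exists s, t; split=> [p|n kn]; first by rewrite mem_cat => /orP[/sP|/tP].
by rewrite A_ell1_count AE VE sbinE // !natrD sE ?tE.
Qed.
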